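(* There exists a formula $\psi(a,b)$ of the first-order language $\mathcal{L}$ with the two free variables $a,b$, which is positive with negated equality allowed, such that for every $3$-dimensional projective space $\Pi$ and all lines $a,b$ of $\Pi$: $\psi(a,b)$ holds in the $\mathcal{L}$-structure of lines of $\Pi$ if and only if $a\sim b$ does not hold. In other words, in three-dimensional projective geometry, non-intersection of two lines is positively definable, with negated equality allowed, in terms of line-intersection.
   Context: $\mathcal{L}$ is the one-sorted first-order language with equality whose only non-logical symbol is a binary relation symbol $\sim$. For a projective space $\Pi$, the $\mathcal{L}$-structure of lines of $\Pi$ has as universe the set of all lines of $\Pi$, and $a\sim b$ is interpreted as ''$a$ and $b$ are different lines which have a point in common''. Thus $a\sim b$ fails exactly when $a=b$ or $a$ and $b$ are skew. A formula of $\mathcal{L}$ is positive with negated equality allowed if it is built from formulas of the forms $x\sim y$, $x=y$ and $x\neq y$ (with $x,y$ variables) using only $\wedge$, $\vee$, $\forall$, $\exists$; in particular $\sim$ is never negated. Dimension means projective dimension; the same formula works for all $3$-dimensional projective spaces. *)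

(* Defs.v *)
From mathcomp Require Import all_boot.
From mathcomp Require Import classical_sets.

Set Implicit Arguments.
Unset Strict Implicit.
Unset Printing Implicit Defensive.

Local Open Scope classical_set_scope.

(* First-order formulas over one binary relation symbol, with equality.
   Variables are natural numbers. *)
Inductive formula : Type :=
  | fRel of nat & nat
  | fEq of nat & nat
  | fNot of formula
  | fAnd of formula & formula
  | fOr of formula & formula
  | fImp of formula & formula
  | fForall of nat & formula
  | fExists of nat & formula.

Fixpoint free_vars (f : formula) : seq nat :=
  match f with
  | fRel x y | fEq x y => [:: x; y]
  | fNot g => free_vars g
  | fAnd g h | fOr g h | fImp g h => free_vars g ++ free_vars h
  | fForall x g | fExists x g => [seq y <- free_vars g | y != x]
  end.

(* Negation may only be applied directly to an equality. *)
Fixpoint positive_neq (f : formula) : bool :=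
  match f with
  | fRel _ _ | fEq _ _ | fNot (fEq _ _) => true
  | fNot _ | fImp _ _ => false
  | fAnd g h | fOr g h => positive_neq g && positive_neq h
  | fForall _ g | fExists _ g => positive_neq g
  end.

Record rel_structure : Type := RelStructure {
  universe :> Type;
  interp : universe -> universe -> Prop }.

Definition update (T : Type) (e : nat -> T) (x : nat) (m : T) : nat -> T :=
  fun y => if y == x then m else e y.

Fixpoint sat (M : rel_structure) (e : nat -> M) (f : formula) : Prop :=
  match f with
  | fRel x y => interp (e x) (e y)
  | fEq x y => e x = e y
  | fNot g => ~ sat e g
  | fAnd g h => sat e g /\ sat e h
  | fOr g h => sat e g \/ sat e h
  | fImp g h => sat e g -> sat e h
  | fForall x g => forall m : M, sat (update e x m) g
  | fExists x g => exists m : M, sat (update e x m) g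
  end.

(* Projective spaces in the sense of Veblen and Young. In [veblen], the four
   inequalities say exactly that the lines ab, cd, ac, bd are determined: if ab
   and cd meet, then so do ac and bd. *)
Record projective_space : Type := ProjectiveSpace {
  point : Type;
  line : Type;
  on : point -> line -> Prop;
  line_through : forall p q : point, p <> q -> exists! l, on p l /\ on q l;
  veblen : forall (a b c d : point) (ab cd ac bd : line),
    a <> b -> c <> d -> a <> c -> b <> d ->
    on a ab /\ on b ab -> on c cd /\ on d cd ->
    on a ac /\ on c ac -> on b bd /\ on d bd ->
    (exists p, on p ab /\ on p cd) -> exists q, on q ac /\ on q bd;
  three_points : forall l : line, exists p q r : point,
    [/\ p <> q, p <> r & q <> r] /\ [/\ on p l, on q l & on r l] }.

Definition subspace (Pi : projective_space) (S : set (point Pi)) : Prop :=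
  forall (p q r : point Pi) (l : line Pi),
    p <> q -> on p l -> on q l -> on r l -> S p -> S q -> S r.

Definition span (Pi : projective_space) (X : set (point Pi)) :
  set (point Pi) := smallest (@subspace Pi) X.

Definition is_basis (Pi : projective_space) (n : nat)
    (p : 'I_n -> point Pi) : Prop :=
  (forall i, ~ span (p @` [set j | j <> i]) (p i)) /\ span (range p) = setT.

(* Projective dimension: a basis has one more point than the dimension. *)
Definition has_dimension (Pi : projective_space) (n : nat) : Prop :=
  exists p : 'I_n.+1 -> point Pi, is_basis p.

Definition intersecting (Pi : projective_space) (a b : line Pi) : Prop :=
  a <> b /\ exists p, on p a /\ on p b.

Definition line_structure (Pi : projective_space) : rel_structure :=
  RelStructure (@intersecting Pi).

(* Main.v *)
From mathcomp Require Import all_boot.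
From mathcomp Require Import boolp classical_sets.
Require Import Defs.

(** Write l ≈ m for: l and m have a point in common, that is, l = m or l ~ m;
    this relation is positive. The formula says that a = b, or

      for every x there is y with y ~ a, y ~ b, y ≈ x such that
      for every z there are u, w with u ~ a, u ~ b, u ≈ y, u ≈ z,
        w ≈ b, y, u, x, z and w <> a.

    Suppose that a and b are skew ([skew_witnessed]). Fix a point A on a and let
    S be the plane through A and b. Every line meets S ([line_meets_plane]), so
    y and u can be taken in S through A and through a point of x, respectively
    of z, and w can be the line of S through these two points. It is not a
    because a is not in S.

    Suppose that a and b are different lines through P, spanning the plane S
    ([meeting_not_witnessed]). Lines that meet both a and b lie in S or pass
    through P. Choose x through a point R of a other than P, outside S. Then y
    cannot both lie in S and pass through P, since it would meet x in R and so
    be a. If y passes through P, take for z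
    a line of S that misses P: now b, u, y are three lines through P that are
    not in one plane, hence w passes through P, and then meeting z forces w
    into S and meeting x forces w through R. If y lies in S, the dual choice,
    z through P and outside S, leads to the same end: w lies in S and passes
    through P and R. Either way w = a.

    The geometry of planes comes from the Veblen-Young axioms by joining a point
    to a subspace: such a cone is a subspace ([subspace_cone]), two lines of a
    plane meet ([coplanar_cone]), and in dimension 3 every line meets every
    plane while no plane contains all points. *)

Set Implicit Arguments.
Unset Strict Implicit.
Unset Printing Implicit Defensive.

Local Open Scope classical_set_scope.

(** * Lines, subspaces and cones *)

Definition touch (Pi : projective_space) (l m : line Pi) : Prop :=
  exists p, on p l /\ on p m.

Definition pts (Pi : projective_space) (l : line Pi) : set (point Pi) :=
  [set p | on p l].

(** The join of [p] and [S], for a subspace [S]. The condition [s <> p] makes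
    this [S] itself, and not all points, when [p] belongs to [S]. *)
Definition cone (Pi : projective_space) (p : point Pi) (S : set (point Pi)) :
    set (point Pi) :=
  [set q | q = p \/
     exists s l, [/\ S s, s <> p & [/\ on p l, on s l & on q l]]].

Lemma line_uniq (Pi : projective_space) (p q : point Pi) (l m : line Pi) :
  p <> q -> on p l -> on q l -> on p m -> on q m -> l = m.
Proof.
move=> pq pl ql pm qm; have [k [_ uk]] := line_through pq.
by rewrite -(uk l) ?(uk m).
Qed.

Lemma join_ex (Pi : projective_space) (p q : point Pi) :
  p <> q -> exists l, on p l /\ on q l.
Proof. by move=> /line_through[l [? _]]; exists l. Qed.

Lemma other_point (Pi : projective_space) (p : point Pi) (l : line Pi) :
  exists q, on q l /\ q <> p.
Proof.
have [q [r [s [[qr qs rs] [ql rl sl]]]]] := three_points l.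
have [qp|] := EM (q = p); last by exists q.
by exists r; split=> // rp; apply: qr; rewrite qp rp.
Qed.

Lemma touchP (Pi : projective_space) (l m : line Pi) :
  l = m \/ intersecting l m <-> touch l m.
Proof.
split=> [[<-|[_ //]]|t].
  by have [p [q [r [_ [pl _ _]]]]] := three_points l; exists p.
by have [|n] := EM (l = m); [left|right].
Qed.

Lemma subspace_pts (Pi : projective_space) (l : line Pi) : subspace (pts l).
Proof.
by move=> p q r m pq pm qm rm pl ql; rewrite /pts /= (line_uniq pq pl ql pm qm).
Qed.

Lemma sub_line (Pi : projective_space) (S : set (point Pi)) p q (l : line Pi) :
  subspace S -> p <> q -> on p l -> on q l -> S p -> S q -> pts l `<=` S.
Proof. by move=> sS pq pl ql Sp Sq r rl; apply: (sS p q r l). Qed.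

Lemma cone_apex (Pi : projective_space) (p : point Pi) S : cone p S p.
Proof. by left. Qed.

Lemma cone_base (Pi : projective_space) (p : point Pi) (S : set (point Pi)) :
  S `<=` cone p S.
Proof.
move=> s Ss; have [->|sp] := EM (s = p); first by left.
have [l [sl pl]] := join_ex sp.
by right; exists s, l.
Qed.

Lemma cone_min (Pi : projective_space) (p : point Pi) (S T : set (point Pi)) :
  subspace T -> T p -> S `<=` T -> cone p S `<=` T.
Proof.
move=> sT Tp ST q [->//|[s [l [Ss sp [pl sl ql]]]]].
by apply: (sT s p q l) => //; apply: ST.
Qed.

(** The source of all intersection points: if [s] and [t] are the projections
    of [q] and [r] from [p], then the lines [qs] and [rt] meet in [p], so
    Veblen's axiom makes the lines [qr] and [st] meet. *)
Lemma cone_secant (Pi : projective_space) (p q r : point Pi) S (l : line Pi) :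
  subspace S -> q <> r -> on q l -> on r l -> cone p S q -> cone p S r ->
  exists t, S t /\ on t l.
Proof.
move=> sS qr ql rl Cq Cr.
have [Sp|nSp] := EM (S p).
  by exists q; split=> //; apply: (@cone_min _ p S S).
(* A line through the apex is a generator of the cone. *)
have onl t : on p l -> t <> p -> on t l -> cone p S t ->
    exists t, S t /\ on t l.
  move=> pl tp tl [//|[s [m [Ss sp [pm sm tm]]]]].
  by exists s; split=> //; rewrite (line_uniq tp tl pl tm pm).
have [pl|npl] := EM (on p l).
  have [qp|qp] := EM (q = p); last exact: (onl q).
  by apply: (onl r) => // rp; apply: qr; rewrite qp rp.
case: Cq => [qp|[s [m [Ss sp [pm sm qm]]]]]; first by case: npl; rewrite -qp.
case: Cr => [rp|[t [n [St tp [pn tn rn]]]]]; first by case: npl; rewrite -rp.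
have [qs|qs] := EM (q = s); first by exists q; rewrite {1}qs.
have [rt|rt] := EM (r = t); first by exists r; rewrite {1}rt.
have st : s <> t.
  move=> E; subst t; apply: npl.
  have mn := line_uniq sp sm pm tn pn.
  by rewrite -mn in rn; rewrite (line_uniq qr ql rl qm rn).
have [k [sk tk]] := join_ex st.
have [|||||||||v [vl vk]] := veblen (a := q) (b := s) (c := r) (d := t)
  (ab := m) (cd := n) (ac := l) (bd := k) => //.
  by exists p.
by exists v; split=> //; apply: (sS s t v k).
Qed.

(** Let [p] be outside [S], let [l] be a line of the cone that misses [p], and [v] its point in [S].
    Project from [p] another point [o] of [l] to [s] in [S]. The lines [ps] and
    [xv] meet in [o], so by Veblen's axiom [px] meets the line [sv], which lies
    in [S]. *)
Lemma subspace_cone (Pi : projective_space) (p : point Pi) S :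
  subspace S -> subspace (cone p S).
Proof.
move=> sS q r x l qr ql rl xl Cq Cr.
have [Sp|nSp] := EM (S p).
  have CS : cone p S `<=` S by apply: cone_min.
  by apply: cone_base; apply: (sS q r x l) => //; apply: CS.
have [v [Sv vl]] := cone_secant sS qr ql rl Cq Cr.
have vp : v <> p by move=> vp; apply: nSp; rewrite -vp.
have [pl|npl] := EM (on p l); first by right; exists v, l.
have xp : x <> p by move=> xp; apply: npl; rewrite -xp.
have [xv|xv] := EM (x = v); first by apply: cone_base; rewrite xv.
have [o [ol Co ov]] : exists o, [/\ on o l, cone p S o & o <> v].
  have [qv|qv] := EM (q = v); last by exists q.
  by exists r; split=> // rv; apply: qr; rewrite qv rv.
case: Co => [op|[s [m [Ss sp [pm sm om]]]]]; first by case: npl; rewrite -op.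
have sv : s <> v.
  by move=> E; subst s; apply: npl; rewrite (line_uniq ov ol vl om sm).
have [k [pk xk]] := join_ex (nesym xp).
have [n [sn vn]] := join_ex sv.
have [|||||||||t [tk tn]] := veblen (a := p) (b := s) (c := x) (d := v)
  (ab := m) (cd := l) (ac := k) (bd := n) => //.
- exact: nesym.
- exact: nesym.
- by exists o.
have St : S t by apply: (sS s v t n).
by right; exists t, k; split=> // tp; apply: nSp; rewrite -tp.
Qed.

(** * Planes *)

Definition coplanar (Pi : projective_space) (T : set (point Pi)) : Prop :=
  forall l m : line Pi, pts l `<=` T -> pts m `<=` T -> touch l m.

Lemma sub_touch (Pi : projective_space) (p : point Pi) S (l : line Pi) :
  subspace S -> pts l `<=` cone p S -> exists t, S t /\ on t l.
Proof.
move=> sS lC; have [q [r [_ [[qr _ _] [ql rl _]]]]] := three_points l.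
by apply: (cone_secant sS qr ql rl); apply: lC.
Qed.

(** Every line of the cone meets the base [b] by projection; the point is to
    replace [b] by an arbitrary line [m] of the cone. This is an exchange: for a
    point [E] of [b] off [m], the cone over [m] with apex [E] contains [b], then
    [A], hence the whole original cone. *)
Lemma coplanar_cone (Pi : projective_space) (A : point Pi) (b : line Pi) :
  ~ on A b -> coplanar (cone A (pts b)).
Proof.
move=> Ab l m lC mC; have sb := @subspace_pts Pi b.
have [mb|mb] := EM (m = b).
  by have [t [tb tl]] := sub_touch sb lC; exists t; rewrite mb.
have [M [Mb Mm]] := sub_touch sb mC.
have [D [Dm DM]] := other_point M m.
have Db : ~ on D b by move=> Db; apply: mb; apply: (line_uniq DM).
have [E [Eb neEM]] := other_point M b.
have sT := subspace_cone (p := E) (@subspace_pts Pi m).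
have TM : cone E (pts m) M by apply: cone_base.
have TD : cone E (pts m) D by apply: cone_base.
have bT : pts b `<=` cone E (pts m).
  by apply: (sub_line sT neEM Eb Mb _ TM); left.
have TA : cone E (pts m) A.
  have [->//|AD] := EM (A = D).
  have [k [Ak Dk]] := join_ex AD.
  have [s [bs sk]] : exists s, pts b s /\ on s k.
    by apply: (cone_secant sb AD Ak Dk); [left|apply: mC].
  have sD : s <> D by move=> sD; apply: Db; rewrite -sD.
  by apply: (sT s D A k) => //; apply: bT.
have [t [tm tl]] := sub_touch (@subspace_pts Pi m)
  (subset_trans lC (cone_min sT TA bT)).
by exists t.
Qed.

Lemma two_lines_through (Pi : projective_space) (A D : point Pi) (b : line Pi) :
  ~ on A b -> cone A (pts b) D ->
  exists l m : line Pi, [/\ l <> m, on D l & on D m] /\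
    (pts l `<=` cone A (pts b) /\ pts m `<=` cone A (pts b)).
Proof.
move=> Ab CD; have sC := subspace_cone (p := A) (@subspace_pts Pi b).
have bC : pts b `<=` cone A (pts b) by apply: cone_base.
have [Db|Db] := EM (on D b).
  have AD : A <> D by move=> AD; apply: Ab; rewrite AD.
  have [k [Ak Dk]] := join_ex AD.
  exists b, k; do !split=> //; first by move=> bk; apply: Ab; rewrite bk.
  exact: (sub_line sC AD Ak Dk (cone_apex _ _)).
have [s [t [_ [[st _ _] [sb tb _]]]]] := three_points b.
have Ds : D <> s by move=> Ds; apply: Db; rewrite Ds.
have Dt : D <> t by move=> Dt; apply: Db; rewrite Dt.
have [l [Dl sl]] := join_ex Ds.
have [m [Dm tm]] := join_ex Dt.
exists l, m; do !split=> //.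
- move=> lm; apply: Db; rewrite -lm in tm.
  by rewrite -(line_uniq st sl tm sb tb).
- by apply: (sub_line sC Ds Dl sl CD); apply: bC.
- by apply: (sub_line sC Dt Dm tm CD); apply: bC.
Qed.

(** Two lines of the plane through a point [D] off [H] meet [H] in different
    points, and these span the trace of the plane on [H]. *)
Lemma plane_trace (Pi : projective_space) (H : set (point Pi)) (A D : point Pi)
    (b : line Pi) :
  subspace H -> (forall l : line Pi, exists t, H t /\ on t l) ->
  ~ on A b -> cone A (pts b) D -> ~ H D ->
  exists m : line Pi, pts m `<=` cone A (pts b) /\ pts m `<=` H.
Proof.
move=> sH hH Ab CD HD; have sC := subspace_cone (p := A) (@subspace_pts Pi b).
have [l [m [[lm Dl Dm] [lC mC]]]] := two_lines_through Ab CD.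
have [M [HM Ml]] := hH l; have [N [HN Nm]] := hH m.
have MD : M <> D by move=> MD; apply: HD; rewrite -MD.
have MN : M <> N by move=> E; subst N; apply: lm; apply: (line_uniq MD).
have [k [Mk Nk]] := join_ex MN.
exists k; split; first by apply: (sub_line sC MN Mk Nk); [apply: lC|apply: mC].
exact: (sub_line sH MN Mk Nk).
Qed.

(** One plane met by every line suffices for all planes to be such. Take a
    point [D] of the second plane off [H]. The planes spanned by [D] and [b]
    and by [D] and [l] have traces [m] and [n] on [H]; these meet in a point
    [M], and the line [DM], which lies in both planes, meets [l]. *)
Lemma hyperplane_transfer (Pi : projective_space) (H : set (point Pi))
    (A : point Pi) (b : line Pi) :
  subspace H -> coplanar H -> (forall l : line Pi, exists t, H t /\ on t l) ->
  ~ on A b -> forall l : line Pi, exists t, cone A (pts b) t /\ on t l.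
Proof.
move=> sH pH hH Ab l; have sC := subspace_cone (p := A) (@subspace_pts Pi b).
have bC : pts b `<=` cone A (pts b) by apply: cone_base.
(* A plane contained in H is all of H. *)
have [CH|] := EM (cone A (pts b) `<=` H).
  have [q [Hq ql]] := hH l; exists q; split=> //.
  have [->|qA] := EM (q = A); first by left.
  have [k [qk Ak]] := join_ex qA.
  have [s [sk sb]] : touch k b.
    apply: pH; last exact: subset_trans CH.
    by apply: (sub_line sH qA qk Ak Hq); apply: CH; left.
  have sA : s <> A by move=> sA; apply: Ab; rewrite -sA.
  by right; exists s, k.
move=> /existsNP[D /not_implyP[CD HD]].
have [Dl|Dl] := EM (on D l); first by exists D.
have [m [mC mH]] := plane_trace sH hH Ab CD HD.
have sT := subspace_cone (p := D) (@subspace_pts Pi l).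
have [n [nT nH]] := plane_trace sH hH Dl (cone_apex _ _) HD.
have [M [Mm Mn]] := pH m n mH nH.
have MD : M <> D by move=> MD; apply: HD; rewrite -MD; apply: mH.
have [k [Mk Dk]] := join_ex MD.
have [q [qk ql]] : touch k l.
  apply: (coplanar_cone Dl); last exact: cone_base.
  by apply: (sub_line sT MD Mk Dk); [apply: nT|left].
by exists q; split=> //; apply: (sC M D q k) => //; apply: mC.
Qed.

(** * Dimension three *)

(** What is used of a basis: it generates, and opposite edges of the
    tetrahedron do not meet. *)
Lemma basis4 (Pi : projective_space) : has_dimension Pi 3 ->
  exists p q r s : point Pi,
    [/\ p <> q, r <> s,
        forall T, subspace T -> T p -> T q -> T r -> T s -> forall x, T x
      & forall l m, on p l -> on q l -> on r m -> on s m -> ~ touch l m].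
Proof.
case=> f [ind spn].
pose i0 := @inord 3 0; pose i1 := @inord 3 1.
pose i2 := @inord 3 2; pose i3 := @inord 3 3.
have cover (i : 'I_4) : [\/ i = i0, i = i1, i = i2 | i = i3].
  case: i => [[|[|[|[|//]]]] ilt];
    [apply: Or41|apply: Or42|apply: Or43|apply: Or44];
    by apply: val_inj; rewrite /= inordK.
have ne (j k : nat) : j < 4 -> k < 4 -> j <> k -> @inord 3 j <> inord k.
  by move=> j4 k4 jk /(congr1 val); rewrite /= !inordK.
have out i :
    ~ forall T, subspace T -> (forall j, j <> i -> T (f j)) -> T (f i).
  move=> allT; apply: (ind i) => T [sT fT].
  by apply: allT => // j ji; apply: fT; exists j.
have inj i j : i <> j -> f i <> f j.
  move=> ij E; apply: (out i) => T sT Tf.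
  by rewrite E; apply: Tf; apply: nesym.
exists (f i0), (f i1), (f i2), (f i3); split.
- by apply: inj; apply: ne.
- by apply: inj; apply: ne.
- move=> T sT T0 T1 T2 T3 x.
  have: span (range f) x by rewrite spn.
  by apply; split=> // _ [i _ <-]; case: (cover i) => ->.
(* A common point of the two edges is on the span of the first two basis points.
   If it differs from the third one, it puts the fourth in the span of the
   others; if it is the third one, that one is in the span of the first two. *)
- move=> l m l0 l1 m2 m3 [t [tl tm]]; apply: (out i3) => T sT Tf.
  have T0 : T (f i0) by apply: Tf; apply: ne.
  have T1 : T (f i1) by apply: Tf; apply: ne.
  have T2 : T (f i2) by apply: Tf; apply: ne.
  have Tt : T t by apply: (sT (f i0) (f i1) t l) => //; apply: inj; apply: ne.
  apply: (sT t (f i2) (f i3) m) => // t2; subst t.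
  apply: (out i2) => U sU Uf; apply: (sU (f i0) (f i1) _ l) => //.
  + by apply: inj; apply: ne.
  + by apply: Uf; apply: ne.
  + by apply: Uf; apply: ne.
Qed.

(** A face [r k] of the tetrahedron is met by every line, because the cone over
    it with apex the remaining vertex [s] is the whole space; the property then
    passes to all planes. *)
Lemma line_meets_plane (Pi : projective_space) (A : point Pi) (b l : line Pi) :
  has_dimension Pi 3 -> ~ on A b -> exists t, cone A (pts b) t /\ on t l.
Proof.
move=> /basis4[p [q [r [s [pq rs gen skew]]]]] Ab.
have [k [pk qk]] := join_ex pq; have [m [rm sm]] := join_ex rs.
have rk : ~ on r k by move=> rk; apply: (skew k m) => //; exists r.
have sH := subspace_cone (p := r) (@subspace_pts Pi k).
apply: (hyperplane_transfer sH (coplanar_cone rk)) => // n.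
apply: (sub_touch (p := s)) => // x _; apply: (gen (cone s (cone r (pts k)))).
- exact: subspace_cone.
- by do 2!apply: cone_base.
- by do 2!apply: cone_base.
- by apply: cone_base; left.
- by left.
Qed.

(** Otherwise opposite edges of the tetrahedron would be in a common plane. *)
Lemma point_off_plane (Pi : projective_space) (A : point Pi) (b : line Pi) :
  has_dimension Pi 3 -> ~ on A b -> exists O, ~ cone A (pts b) O.
Proof.
move=> /basis4[p [q [r [s [pq rs _ skew]]]]] Ab.
have [k [pk qk]] := join_ex pq; have [m [rm sm]] := join_ex rs.
apply/existsNP => all; apply: (skew k m) => //.
by apply: (coplanar_cone Ab) => x _; apply: all.
Qed.

(** * The geometric condition *)

Definition witnessed (Pi : projective_space) (a b : line Pi) : Prop :=
  forall x : line Pi, exists y : line Pi,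
    [/\ intersecting y a, intersecting y b, touch y x &
    forall z : line Pi, exists u w : line Pi,
      [/\ intersecting u a, intersecting u b, touch u y & touch u z] /\
      [/\ touch w b, touch w y, touch w u & [/\ touch w x, touch w z & w <> a]]].

(** The hypothesis on [q] serves the case [t = A], where any line of [S] through
    [A] will do. *)
Lemma line_within (Pi : projective_space) (A t : point Pi) (S : set (point Pi)) :
  subspace S -> S A -> S t -> (exists q, S q /\ q <> A) ->
  exists l : line Pi, [/\ on A l, on t l & pts l `<=` S].
Proof.
move=> sS SA St [q [Sq qA]].
have [E|tA] := EM (t = A).
  have [l [ql Al]] := join_ex qA; exists l; split=> //; first by rewrite E.
  exact: (sub_line sS qA ql Al).
by have [l [tl Al]] := join_ex tA; exists l; split=> //; apply: (sub_line sS tA).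
Qed.

Lemma skew_witnessed (Pi : projective_space) (a b : line Pi) :
  has_dimension Pi 3 -> ~ touch a b -> witnessed a b.
Proof.
move=> dim ab; have [A [_ [_ [_ [Aa _ _]]]]] := three_points a.
have Ab : ~ on A b by move=> Ab; apply: ab; exists A.
pose S := cone A (pts b).
have sS : subspace S by apply: subspace_cone; apply: subspace_pts.
have bS : pts b `<=` S by apply: cone_base.
have SA : S A by left.
have pS := coplanar_cone Ab.
have aS l : pts l `<=` S -> l <> a.
  by move=> lS E; subst l; apply: ab; apply: pS.
(* Lines of S through A are the candidates for y and u. *)
have row x : exists y : line Pi, [/\ intersecting y a, intersecting y b,
    pts y `<=` S & exists t, [/\ S t, on t x & on t y]].
  have [t [St tx]] := line_meets_plane x dim Ab.
  have [|l [Al tl lS]] := line_within sS SA St.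
    have [B [Bb BA]] := other_point A b.
    by exists B; split=> //; apply: bS.
  exists l; split=> //; last by exists t.
    by split; [apply: aS|exists A].
  by split; [move=> lb; apply: Ab; rewrite -lb|apply: pS].
move=> x; have [y [ya yb yS [t [St tx ty]]]] := row x.
exists y; split=> //; first by exists t.
move=> z; have [u [ua ub uS [v [Sv vz vu]]]] := row z.
have [|w [tw vw wS]] := line_within sS St Sv.
  by have [q [qy qt]] := other_point t y; exists q; split=> //; apply: yS.
exists u, w; split; split=> //; try exact: pS.
  by exists v.
split; [by exists t|by exists v|exact: aS].
Qed.

Lemma line_in (Pi : projective_space) (S : set (point Pi)) (P : point Pi)
    (a b l : line Pi) :
  subspace S -> pts a `<=` S -> pts b `<=` S -> a <> b -> on P a -> on P b ->
  touch l a -> touch l b -> ~ on P l -> pts l `<=` S.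
Proof.
move=> sS aS bS ab Pa Pb [q [ql qa]] [r [rl rb]] Pl.
apply: (sub_line sS _ ql rl (aS _ qa) (bS _ rb)) => E; subst r.
have qP : q <> P by move=> qP; apply: Pl; rewrite -qP.
by apply: ab; apply: (line_uniq qP).
Qed.

(** The lines that refute the condition are [x], joining a point [R] of [a] to a point [O]
    off the plane [S] of [a] and [b], and then, depending on the answer [y],
    either a line of [S] off [P] or the line [PO]. The second choice is dual to
    the first: points and planes are exchanged, and so are [P] and [S]. *)
Lemma meeting_not_witnessed (Pi : projective_space) (a b : line Pi) :
  has_dimension Pi 3 -> intersecting a b -> ~ witnessed a b.
Proof.
move=> dim [ab [P [Pa Pb]]] W.
have [R [Ra RP]] := other_point P a.
have Rb : ~ on R b by move=> Rb; apply: ab; apply: (line_uniq RP).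
have [O SO] := point_off_plane dim Rb.
move: SO; set S := cone R (pts b) => SO.
have sS : subspace S by apply: subspace_cone; apply: subspace_pts.
have bS : pts b `<=` S by apply: cone_base.
have SP : S P by apply: bS.
have SR : S R by left.
have aS : pts a `<=` S by apply: (sub_line sS RP).
have trace l q r : ~ pts l `<=` S -> on q l -> S q -> on r l -> S r -> q = r.
  move=> lS ql Sq rl Sr; apply: contrapT => qr.
  by apply: lS; apply: (sub_line sS qr).
have RO : R <> O by move=> E; rewrite -E in SO.
have PO : P <> O by move=> E; rewrite -E in SO.
have [x [Rx Ox]] := join_ex RO.
have xS : ~ pts x `<=` S by move=> xS; apply: SO; apply: xS.
have Px : ~ on P x by move=> Px; apply: RP; apply: (trace x).
(* R is the only point of x in S. *)
have onR l : pts l `<=` S -> touch l x -> on R l.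
  by move=> lS [t [tl tx]]; rewrite (trace x R t) //; apply: lS.
have [y [[ya ta] [yb tb] yx Wy]] := W x.
have [Py|Py] := EM (on P y).
  have yS : ~ pts y `<=` S.
    by move=> yS; apply: ya; apply: (line_uniq RP) => //; apply: onR.
  have [B [Bb BP]] := other_point P b.
  have RB : R <> B by move=> E; apply: Rb; rewrite E.
  have [z [Rz Bz]] := join_ex RB.
  have zS : pts z `<=` S by apply: (sub_line sS RB) => //; apply: bS.
  have Pz : ~ on P z.
    move=> Pz; apply: Rb.
    by rewrite (line_uniq BP Bb Pb Bz Pz).
  have [u [w [[[ua tua] [ub tub] uy uz] [wb wy wu [wx wz wa]]]]] := Wy z.
  (* A line missing P and meeting two lines of S through P lies in S, where y
     has no point other than P. *)
  have star l c d : pts c `<=` S -> pts d `<=` S -> c <> d -> on P c ->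
      on P d -> touch l c -> touch l d -> touch l y -> on P l.
    move=> cS dS cd Pc Pd lc ld [t [tl ty]]; apply: contrapT => Pl.
    have lS := line_in sS cS dS cd Pc Pd lc ld Pl.
    by apply: Pl; rewrite (trace y P t) //; apply: lS.
  have flat l : on P l -> touch l z -> pts l `<=` S.
    move=> Pl [t [tl tz]]; apply: (sub_line sS _ Pl tl SP (zS _ tz)) => E.
    by apply: Pz; rewrite E.
  have Pu : on P u by apply: (star u a b).
  have uS := flat u Pu uz.
  have Pw : on P w by apply: (star w b u) => //; apply: nesym.
  have wS := flat w Pw wz.
  by apply: wa; apply: (line_uniq RP) => //; apply: onR.
have yS := line_in sS aS bS ab Pa Pb ta tb Py.
have [z [Pz Oz]] := join_ex PO.
have zS : ~ pts z `<=` S by move=> zS; apply: SO; apply: zS.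
have [u [w [[[ua tua] [ub tub] uy uz] [wb wy wu [wx wz wa]]]]] := Wy z.
(* A line through P meeting y has a second point in S. *)
have plane l c d : pts c `<=` S -> pts d `<=` S -> c <> d -> on P c ->
    on P d -> touch l c -> touch l d -> touch l y -> pts l `<=` S.
  move=> cS dS cd Pc Pd lc ld [t [tl ty]].
  have [Pl|Pl] := EM (on P l); last exact: (line_in sS cS dS cd Pc Pd).
  apply: (sub_line sS _ Pl tl SP (yS _ ty)) => E.
  by apply: Py; rewrite E.
have onP l : pts l `<=` S -> touch l z -> on P l.
  by move=> lS [t [tl tz]]; rewrite (trace z P t) //; apply: lS.
have uS : pts u `<=` S by apply: (plane u a b).
have Pu := onP u uS uz.
have wS : pts w `<=` S by apply: (plane w b u) => //; apply: nesym.
by apply: wa; apply: (line_uniq RP) => //; [apply: onR|apply: onP].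
Qed.

(** * The formula *)

Definition fTouch (i j : nat) : formula := fOr (fEq i j) (fRel i j).

(** The variables 0, ..., 6 stand for a, b, x, y, z, u, w. *)
Definition skewness : formula :=
  fOr (fEq 0 1) (fForall 2 (fExists 3
    (fAnd (fAnd (fRel 3 0) (fAnd (fRel 3 1) (fTouch 3 2)))
    (fForall 4 (fExists 5 (fExists 6
      (fAnd
        (fAnd (fAnd (fRel 5 0) (fRel 5 1)) (fAnd (fTouch 5 3) (fTouch 5 4)))
        (fAnd (fAnd (fTouch 6 1) (fAnd (fTouch 6 3) (fTouch 6 5)))
          (fAnd (fTouch 6 2) (fAnd (fTouch 6 4) (fNot (fEq 6 0)))))))))))).

Lemma sat_skewness (Pi : projective_space) (e : nat -> line_structure Pi) :
  sat e skewness <-> e 0 = e 1 \/ witnessed (e 0) (e 1).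
Proof.
split=> -[E|W]; [by left|right|by left|right].
- move=> x; have [y [[ya [yb /touchP yx]] Wy]] := W x.
  exists y; split=> // z.
  have [u [w [[[ua ub] [/touchP uy /touchP uz]] rest]]] := Wy z.
  case: rest => [[/touchP wb [/touchP wy /touchP wu]]].
  by case=> /touchP wx [/touchP wz wa]; exists u, w.
- move=> x; have [y [ya yb /touchP yx Wy]] := W x.
  exists y; split=> // z.
  have [u [w [[ua ub /touchP uy /touchP uz]]]] := Wy z.
  case=> /touchP wb /touchP wy /touchP wu [/touchP wx /touchP wz wa].
  by exists u, w.
Qed.

Theorem mainTheorem2 :
  exists psi : formula,
    [/\ free_vars psi =i [:: 0; 1],
        positive_neq psi
      & forall Pi : projective_space, has_dimension Pi 3 ->
        forall (a b : line Pi) (e : nat -> line_structure Pi),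
          e 0 = a -> e 1 = b ->
          (sat e psi <-> ~ intersecting a b)].
Proof.
exists skewness; split=> //; first by move=> [|[|n]].
move=> Pi dim a b e <- <-; rewrite sat_skewness; split=> [[E [] //|W I]|nI].
  exact: (meeting_not_witnessed dim I W).
have [E|ne] := EM (e 0 = e 1); first by left.
by right; apply: skew_witnessed => // t; apply: nI.
Qed.
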